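(* Let $\circledast$ be a proper multiplication on $\mathbb{Z}^d$ which is not commutative, i.e. $\circledast\neq\circledast_{\mathrm{op}}$. There exists a subset of $\mathbb{Z}^d_{\neq0}$ which is $\mathrm{IP}$ in the semigroup $(\mathbb{Z}^d_{\neq0},\circledast)$ but not $\mathrm{IP}$ in the semigroup $(\mathbb{Z}^d_{\neq0},\circledast_{\mathrm{op}})$.
   Context: A proper multiplication on $\mathbb{Z}^d$ is a binary operation $\circledast:\mathbb{Z}^d\times\mathbb{Z}^d\to\mathbb{Z}^d$ making $(\mathbb{Z}^d,+)$ an associative (not necessarily commutative or unital) ring without zero divisors; $\mathbb{Z}^d_{\neq0}=\mathbb{Z}^d\setminus\{0\}$; $x\circledast_{\mathrm{op}}y=y\circledast x$. In a semigroup $(S,\cdot)$, $A$ is $\mathrm{IP}$ if there is a sequence $(s_i)_{i\in\mathbb{N}}$ in $S$ such that $A$ contains all products $s_{i_1}\cdot s_{i_2}\cdots s_{i_k}$ with $k\ge1$ and $i_1<\dots<i_k$ in $\mathbb{N}$ (factors in increasing order of index). *)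

(* Defs.v *)
From HB Require Import structures.
From mathcomp Require Import all_boot all_order all_algebra.
From mathcomp Require Import classical_sets.

Set Implicit Arguments.
Unset Strict Implicit.
Unset Printing Implicit Defensive.

Import GRing.Theory.
Local Open Scope ring_scope.

Record proper_mult (d : nat)
    (mul : 'rV[int]_d -> 'rV[int]_d -> 'rV[int]_d) : Prop := ProperMult {
  pm_mulA : associative mul;
  pm_mulDl : left_distributive mul +%R;
  pm_mulDr : right_distributive mul +%R;
  pm_integral : forall x y, mul x y = 0 -> x = 0 \/ y = 0
}.

Definition mul_op (d : nat) (mul : 'rV[int]_d -> 'rV[int]_d -> 'rV[int]_d) :=
  fun x y : 'rV[int]_d => mul y x.

Lemma proper_mult_op (d : nat)
    (mul : 'rV[int]_d -> 'rV[int]_d -> 'rV[int]_d) :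
  proper_mult mul -> proper_mult (mul_op mul).
Proof.
case=> mA mDl mDr mI; split; rewrite /mul_op.
- by move=> x y z; rewrite mA.
- by move=> x y z; rewrite mDr.
- by move=> x y z; rewrite mDl.
- by move=> x y /mI[]; [right | left].
Qed.

Definition Znz (d : nat) := {x : 'rV[int]_d | x != 0}.

Lemma proper_mult_neq0 (d : nat)
    (mul : 'rV[int]_d -> 'rV[int]_d -> 'rV[int]_d) (H : proper_mult mul)
    (x y : Znz d) : mul (val x) (val y) != 0.
Proof.
by apply/eqP => /(pm_integral H)[] /eqP; apply/negP;
  [exact: (valP x) | exact: (valP y)].
Qed.

Definition nzmul (d : nat) (mul : 'rV[int]_d -> 'rV[int]_d -> 'rV[int]_d)
    (H : proper_mult mul) (x y : Znz d) : Znz d :=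
  exist _ (mul (val x) (val y)) (proper_mult_neq0 H x y).

Lemma nzmulA (d : nat) (mul : 'rV[int]_d -> 'rV[int]_d -> 'rV[int]_d)
    (H : proper_mult mul) : associative (nzmul H).
Proof. by move=> x y z; apply: val_inj; apply: (pm_mulA H). Qed.

HB.instance Definition _ (d : nat)
    (mul : 'rV[int]_d -> 'rV[int]_d -> 'rV[int]_d) (H : proper_mult mul) :=
  SemiGroup.isLaw.Build (Znz d) (nzmul H) (nzmulA H).

(* The nonempty increasing index list is i :: r, and the foldl is
   the product s_i * s_(r_0) * s_(r_1) * ... in this order. *)
Definition IP (S : Type) (op : SemiGroup.law S) (A : set S) : Prop :=
  exists s : nat -> S, forall (i : nat) (r : seq nat),
    sorted ltn (i :: r) -> A (foldl op (s i) (map s r)).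

(* Main.v *)
Require Import Defs.
From HB Require Import structures.
From mathcomp Require Import all_boot all_order all_algebra.
From mathcomp Require Import boolp classical_sets.

Set Implicit Arguments.
Unset Strict Implicit.
Unset Printing Implicit Defensive.

Import GRing.Theory Num.Theory.
Local Open Scope ring_scope.

(** Choose [s 0, s 1, ...] one at a time. Let [L n] be the finite list of
    products of increasing words in the letters of index below [n], and [W n]
    that of the words ending in [s n]. If [s n] avoids finitely many proper
    subgroups and is then multiplied by a large integer, a product [x * y] with
    [x] in [W n] and [y] in [L n.+1] never lies in [L n.+1], and a product of
    two elements of [L n] never lies in [W n]. The only case in which both sides
    are linear in [s n] is [g * s n * f = h * s n]; it is a proper condition on
    [s n] because [f] is not central, and non-centrality of all the words is
    kept by requiring that none commutes with a fixed non-central [c].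
    Hence if [x], [y] and [x * y] are in the union of the [W n], then the last
    index of [x] is smaller than that of [y], so that an IP sequence for the
    opposite product would produce an infinite descent in [nat]. *)

(** * Large multiples of lattice vectors *)

Definition eventually (P : nat -> Prop) : Prop :=
  exists M, forall m, (M <= m)%N -> P m.

Lemma eventually_seq (I : eqType) (s : seq I) (P : I -> nat -> Prop) :
  {in s, forall i, eventually (P i)} ->
  eventually (fun m => {in s, forall i, P i m}).
Proof.
elim: s => [|i s IHs] Ps; first by exists 0%N.
have [M1 PM1] := Ps i (mem_head i s).
have [j js|M2 PM2] := IHs; first by apply: Ps; rewrite inE js orbT.
exists (maxn M1 M2) => m; rewrite geq_max => /andP[M1m M2m] j.
by rewrite inE => /predU1P[->|js]; [exact: PM1 | exact: PM2].
Qed.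

Lemma eventually_seq2 (I J : eqType) (s : seq I) (t : seq J)
    (P : I -> J -> nat -> Prop) :
  {in s & t, forall i j, eventually (P i j)} ->
  eventually (fun m => {in s & t, forall i j, P i j m}).
Proof.
move=> Pst.
have [|M PM] := @eventually_seq _ s (fun i m => {in t, forall j, P i j m}).
  by move=> i si; apply: eventually_seq => j tj; apply: Pst.
by exists M => m Mm i j si tj; apply: PM.
Qed.

Lemma eventually_and (P Q : nat -> Prop) :
  eventually P -> eventually Q -> eventually (fun m => P m /\ Q m).
Proof.
move=> [M PM] [N QN]; exists (maxn M N) => m.
by rewrite geq_max => /andP[Mm Nm]; split; [exact: PM | exact: QN].
Qed.

Lemma rV_mulrn_neq0 (d : nat) (x : 'rV[int]_d) (m : nat) :
  x != 0 -> (0 < m)%N -> x *+ m != 0.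
Proof.
move=> /rV0Pn[j xj] m0; apply/rV0Pn; exists j.
by rewrite mulmxnE mulrn_eq0 negb_or xj -lt0n m0.
Qed.

(** The lattice is torsion-free, so at most one multiple of [a] equals [b]. *)
Lemma eventually_mulrn_neq (d : nat) (a b : 'rV[int]_d) :
  a != 0 -> eventually (fun m => a *+ m != b).
Proof.
move=> a0; have [[m0 am0]|nob] := pselect (exists m, a *+ m = b); last first.
  by exists 0%N => m _; apply/eqP => abm; apply: nob; exists m.
exists m0.+1 => m m0m; rewrite -am0 -subr_eq0 -mulrnBr ?(ltnW m0m)//.
by rewrite rV_mulrn_neq0// subn_gt0.
Qed.

Lemma eventually_mulrn_sqr_neq (d : nat) (a b : 'rV[int]_d) :
  a != 0 -> eventually (fun m => a *+ (m * m) != b).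
Proof.
move=> /(eventually_mulrn_neq b)[M HM]; exists M.+1 => m Mm; apply: HM.
by apply: leq_trans (ltnW Mm) _; rewrite leq_pmulr// (leq_ltn_trans _ Mm).
Qed.

Lemma eventually_mulrn_sqr_neq_mulrn (d : nat) (a b : 'rV[int]_d) :
  a != 0 -> eventually (fun m => a *+ (m * m) != b *+ m).
Proof.
move=> /(eventually_mulrn_neq b)[M HM]; exists M.+1 => m Mm.
rewrite mulrnA -subr_eq0 -mulrnBl rV_mulrn_neq0 ?(leq_ltn_trans _ Mm)//.
by rewrite subr_eq0 HM// ltnW.
Qed.

(* A lattice is not a finite union of kernels of nonzero homomorphisms. *)
Lemma avoid_kernels (d : nat) (I : eqType) (s : seq I)
    (phi : I -> 'rV[int]_d -> 'rV[int]_d) :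
  (forall i, {morph phi i : x y / x + y}) ->
  {in s, forall i, exists x, phi i x != 0} ->
  exists z, {in s, forall i, phi i z != 0}.
Proof.
move=> phiD; elim: s => [|i s IHs] phi_neq0; first by exists 0.
have [j js|z phiz] := IHs; first by apply: phi_neq0; rewrite inE js orbT.
have [phiiz|phiiz] := eqVneq (phi i z) 0; last first.
  by exists z => j; rewrite inE => /predU1P[->//|]; exact: phiz.
have [y phiy] := phi_neq0 i (mem_head i s).
have phi0 j : phi j 0 = 0 by apply: (addrI (phi j 0)); rewrite -phiD !addr0.
have phiMn j x m : phi j (x *+ m) = phi j x *+ m.
  by elim: m => [|m IHm]; rewrite ?mulr0n// !mulrS phiD IHm.
have [j js|M HM] := @eventually_seq _ s
    (fun j m => phi j z *+ m != - phi j y).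
  exact/eventually_mulrn_neq/phiz.
(* [phi i] kills [z], so [y] alone decides there; on [s] a large multiple of [z] cannot cancel
   [y]. *)
exists (z *+ M + y) => j; rewrite inE phiD phiMn => /predU1P[->|js].
  by rewrite phiiz mul0rn add0r.
by rewrite addr_eq0 HM.
Qed.

(** * Cancellation and generic elements in a ring without zero divisors *)

Section ProperMult.
Variables (d : nat) (mul : 'rV[int]_d -> 'rV[int]_d -> 'rV[int]_d).
Hypothesis H : proper_mult mul.
Local Notation V := 'rV[int]_d.

Lemma pm_mul0l x : mul 0 x = 0.
Proof. by apply: (addrI (mul 0 x)); rewrite -(pm_mulDl H) !addr0. Qed.

Lemma pm_mul0r x : mul x 0 = 0.
Proof. by apply: (addrI (mul x 0)); rewrite -(pm_mulDr H) !addr0. Qed.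

Lemma pm_mulMnl x y m : mul (x *+ m) y = mul x y *+ m.
Proof.
by elim: m => [|m IHm]; rewrite ?mulr0n ?pm_mul0l// !mulrS (pm_mulDl H) IHm.
Qed.

Lemma pm_mulMnr x y m : mul x (y *+ m) = mul x y *+ m.
Proof.
by elim: m => [|m IHm]; rewrite ?mulr0n ?pm_mul0r// !mulrS (pm_mulDr H) IHm.
Qed.

Lemma pm_mul_neq0 x y : x != 0 -> y != 0 -> mul x y != 0.
Proof. by move=> /eqP x0 /eqP y0; apply/eqP => /(pm_integral H)[]. Qed.

Lemma pm_mulI x : x != 0 -> injective (mul x).
Proof.
move=> x0 y z xyz; apply/eqP; rewrite -subr_eq0; apply: contraTT isT => yz0.
have := pm_mul_neq0 x0 yz0.
have -> : mul x (y - z) = 0.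
  by apply: (addIr (mul x z)); rewrite -(pm_mulDr H) subrK add0r.
by rewrite eqxx.
Qed.

Definition central x := forall y, mul x y = mul y x.

(* [None] plays the role of a unit, which the ring need not have. *)
Definition lmul (g : option V) (z : V) : V := if g is Some x then mul x z else z.

Lemma lmulD g : {morph lmul g : x y / x + y}.
Proof. by case: g => [g|] x y //=; rewrite (pm_mulDr H). Qed.

Lemma lmulMn g x m : lmul g (x *+ m) = lmul g x *+ m.
Proof. by case: g => [g|] //=; rewrite pm_mulMnr. Qed.

Lemma lmul_neq0 g z : g != Some 0 -> z != 0 -> lmul g z != 0.
Proof. by case: g => [g|] //= g0 z0; apply: pm_mul_neq0. Qed.

Lemma lmulA g x y : lmul g (mul x y) = mul (lmul g x) y.
Proof. by case: g => [g|] //=; rewrite (pm_mulA H). Qed.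

(** Evaluating the identity at [z0 * x] and at [z0] gives [g * z0 * x * f = h * z0 * x = g * z0 * f
    * x]; then cancel [g * z0] on the left. *)
Lemma lmul_central (g h : option V) (f z0 : V) : g != Some 0 -> z0 != 0 ->
  (forall z, mul (lmul g z) f = lmul h z) -> central f.
Proof.
move=> g0 z00 gfh x; apply: (pm_mulI (lmul_neq0 g0 z00)).
by rewrite !(pm_mulA H) gfh -(lmulA g z0 x) gfh lmulA.
Qed.

Lemma generic_element (G K : seq (option V)) (F : seq V) (z0 : V) : z0 != 0 ->
  Some 0 \notin G -> {in F, forall f, ~ central f} ->
  exists z, forall g h f, g \in G -> h \in K -> f \in F ->
    mul (lmul g z) f != lmul h z.
Proof.
move=> z00 G0 Fnc.
pose phi (i : option V * option V * V) z :=
  mul (lmul i.1.1 z) i.2 - lmul i.1.2 z.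
pose s := [seq (gh, f) | gh <- [seq (g, h) | g <- G, h <- K], f <- F].
have [i x y|_ /allpairsP[[gh f] [/= /allpairsP[[g h] [/= gG _ ->]] fF ->]]|z phiz]
    := @avoid_kernels d _ s phi.
- by rewrite /phi !lmulD (pm_mulDl H) opprD addrACA.
- apply: contrapT => nophi; apply: (Fnc f fF).
  apply: (@lmul_central g h f z0) => // [|x]; first by apply: contraNneq G0 => <-.
  by apply/eqP; rewrite -subr_eq0; apply: contra_notT nophi; exists x.
- exists z => g h f gG hK fF; rewrite -subr_eq0.
  by apply: (phiz (g, h, f)); do 2![apply: allpairs_f => //].
Qed.

(* The products of increasing words ending in the letter [z], if [L] lists those
   in the preceding letters. *)
Definition words_ending (L : seq V) (z : V) : seq V :=
  [seq lmul g z | g <- None :: map Some L].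

Definition separating c L z :=
  let E := words_ending L z in
  [/\ {in E, forall x, mul x c != mul c x},
      {in L &, forall x y, mul x y \notin E} &
      {in E & L ++ E, forall x y, mul x y \notin L ++ E}].

(** For a generic [z] scaled by [m], both sides of each forbidden equality are homogeneous in [m],
    of degree at most 2. Unequal degrees disagree for large [m]; equal degrees are excluded by the
    choice of [z]. *)
Lemma exists_separating c L : {in L, forall x, mul x c != mul c x} ->
  ~ central c -> exists z, separating c L z.
Proof.
move=> Lc cnc; pose G := None :: map Some L.
have Lnc : {in L, forall f, ~ central f}.
  by move=> f /Lc/eqP fc fcent; apply: fc; apply: fcent.
have c0 : c != 0.
  by apply: contra_notN cnc => /eqP-> y; rewrite pm_mul0l pm_mul0r.
have G0 : Some 0 \notin G.
  rewrite inE /=; apply/mapP => -[x /Lc/eqP xc [x0]].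
  by apply: xc; rewrite -x0 pm_mul0l pm_mul0r.
(* The second half of [K] holds the products [c * g]: with right factor [c], genericity then says
   that [g * z] does not commute with [c]. *)
pose K := G ++ [seq Some (if g is Some x then mul c x else c) | g <- G].
have [f|z gen] := @generic_element G K (c :: L) c c0 G0.
  by rewrite inE => /predU1P[->//|]; apply: Lnc.
have zc g : g \in G -> mul (lmul g z) c != mul c (lmul g z).
  move=> gG; pose h := Some (if g is Some x then mul c x else c).
  have -> : mul c (lmul g z) = lmul h z by case: (g) @h => //= x; rewrite (pm_mulA H).
  by apply: gen; rewrite ?mem_head// mem_cat; apply/orP; right; apply: map_f.
have gz0 g : g \in G -> lmul g z != 0.
  by move=> /zc; apply: contraNneq => ->; rewrite pm_mul0l pm_mul0r.
have ggz0 g h : g \in G -> h \in G -> mul (lmul g z) (lmul h z) != 0.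
  by move=> gG hG; apply: pm_mul_neq0; apply: gz0.
have Lneq0 x : x \in L -> x != 0.
  by move=> /Lc; apply: contraNneq => ->; rewrite pm_mul0l pm_mul0r.
have ev1 : eventually (fun m => {in [seq mul x y | x <- L, y <- L] & G,
    forall x g, lmul g z *+ m != x}).
  by apply: eventually_seq2 => x g _ gG; apply: eventually_mulrn_neq; apply: gz0.
have ev2 : eventually (fun m =>
    {in [seq mul (lmul g z) y | g <- G, y <- L] & L, forall x y, x *+ m != y}).
  apply: eventually_seq2 => _ y /allpairsP[[g x] [/= gG xL ->]] _.
  by apply: eventually_mulrn_neq; rewrite pm_mul_neq0 ?gz0 ?Lneq0.
pose GG := [seq mul (lmul g z) (lmul h z) | g <- G, h <- G].
have ev3 : eventually (fun m => {in GG & L, forall x y, x *+ (m * m) != y}).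
  apply: eventually_seq2 => _ y /allpairsP[[g h] [/= gG hG ->]] _.
  exact/eventually_mulrn_sqr_neq/ggz0.
have ev4 : eventually (fun m =>
    {in GG & G, forall x g, x *+ (m * m) != lmul g z *+ m}).
  apply: eventually_seq2 => _ k /allpairsP[[g h] [/= gG hG ->]] _.
  exact/eventually_mulrn_sqr_neq_mulrn/ggz0.
have [M HM] := eventually_and (eventually_and ev1 ev2) (eventually_and ev3 ev4).
(* A successor is nonzero, so multiplication by it can be cancelled. *)
have [[HM1 HM2] [HM3 HM4]] := HM M.+1 (leqnSn M).
have MnI (x y : V) : x *+ M.+1 == y *+ M.+1 -> x == y.
  by rewrite -subr_eq0 -mulrnBl; apply: contraTT; rewrite -subr_eq0 => /rV_mulrn_neq0->.
exists (z *+ M.+1); split.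
- move=> _ /mapP[g gG ->]; rewrite lmulMn pm_mulMnl pm_mulMnr.
  by apply/negP => /MnI; apply/negP; apply: zc.
- move=> x y xL yL; apply/mapP => -[g gG] /eqP; rewrite lmulMn eq_sym.
  by apply/negP; apply: HM1 => //; apply: allpairs_f.
- move=> _ y /mapP[g gG ->]; rewrite !mem_cat lmulMn pm_mulMnl.
  case/orP => [yL|/mapP[h hG ->]].
    apply/norP; split.
      apply/negP => gyL.
      by have := HM2 _ _ (allpairs_f (fun g y => mul (lmul g z) y) gG yL) gyL; rewrite eqxx.
    apply/mapP => -[h hG] /eqP; rewrite lmulMn => /MnI; apply/negP.
    by apply: gen; rewrite // ?mem_cat ?hG// inE yL orbT.
  have ghG := allpairs_f (fun g h => mul (lmul g z) (lmul h z)) gG hG.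
  rewrite lmulMn pm_mulMnr -mulrnA; apply/norP; split.
    by apply/negP => /(HM3 _ _ ghG); rewrite eqxx.
  by apply/mapP => -[k kG] /eqP; rewrite lmulMn; apply/negP; apply: HM4.
Qed.

Lemma separating_sequence c : ~ central c ->
  exists (s : nat -> V) (L : nat -> seq V),
    forall n, L n.+1 = L n ++ words_ending (L n) (s n) /\
              separating c (L n) (s n).
Proof.
move=> cnc.
have /choice[f fP] : forall L, exists z,
    {in L, forall x, mul x c != mul c x} -> separating c L z.
  move=> L; have [Lc|nLc] := pselect {in L, forall x, mul x c != mul c x}.
    by have [z] := exists_separating Lc cnc; exists z.
  (* A junk value making the choice function total; the induction below shows that the lists [L n]
     never reach this case. *)
  by exists 0.
pose L n := iter n (fun L => L ++ words_ending L (f L)) [::].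
exists (f \o L), L => n; split=> //; apply: (fP).
elim: n => [//|n IHn] x; rewrite /= mem_cat => /orP[/IHn//|].
by have [+ _ _] := fP _ IHn; apply.
Qed.

End ProperMult.

(** * The separating set and the descent *)

Theorem theorem6p2 (d : nat) (mul : 'rV[int]_d -> 'rV[int]_d -> 'rV[int]_d)
    (Hmul : proper_mult mul) (Hnc : ~ commutative mul) :
  exists A : set (Znz d),
    IP (nzmul Hmul) A /\ ~ IP (nzmul (proper_mult_op Hmul)) A.
Proof.
have [c cnc] : exists c, ~ central mul c.
  by apply: contrapT => nex; apply: Hnc => x; apply: contrapT => nc; apply: nex; exists x.
have [s [L sL]] := separating_sequence Hmul cnc.
pose W n := words_ending mul (L n) (s n).
have LS n : L n.+1 = L n ++ W n by have [] := sL n.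
have Lmono m n : (m <= n)%N -> {subset L m <= L n}.
  elim: n => [|n IHn]; first by rewrite leqn0 => /eqP->.
  rewrite leq_eqVlt => /predU1P[->//|/IHn Lmn x /Lmn xL].
  by rewrite LS mem_cat xL.
have WL m n : (m < n)%N -> {subset W m <= L n}.
  by move=> mn x xW; apply: (Lmono _ _ mn); rewrite LS mem_cat xW orbT.
have s0 n : s n != 0.
  have [_ [/(_ (s n) (mem_head _ _)) + _ _]] := sL n.
  by apply: contraNneq => ->; rewrite (pm_mul0l Hmul) (pm_mul0r Hmul).
pose S n : Znz d := exist _ (s n) (s0 n).
exists [set x | exists n, val x \in W n]%classic; split.
  (* A word lies in the [W] of its last index, hence the induction from the right end. *)
  exists S => i r ir; exists (last i r); elim/last_ind: r ir => [_|r n IHr].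
    exact: mem_head.
  rewrite /= rcons_path last_rcons map_rcons foldl_rcons => /andP[/IHr rW rn] /=.
  apply/mapP; exists (Some (val (foldl (nzmul Hmul) (S i) (map S r)))) => //.
  by rewrite inE /=; apply: map_f; apply: (WL _ _ rn).
have Wlt a b k x y : x \in W a -> y \in W b -> mul x y \in W k -> (a < b)%N.
  move=> xa yb xyk; rewrite ltnNge; apply/negP => ba.
  (* If [k <= a], the product would fall in [L a.+1], against the third clause at [a]; otherwise
     both factors lie in [L k], against the second clause at [k]. *)
  have [ka|ak] := leqP k a.
    have [_ [_ _ /(_ x y xa)]] := sL a.
    by rewrite -LS (WL b)// (WL k)// => /(_ isT).
  have [_ [_ /(_ x y) + _]] := sL k.
  rewrite (WL a)// (WL b) ?(leq_ltn_trans ba)// => /(_ isT isT).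
  by rewrite xyk.
case=> t tA.
have /choice[n nP] : forall j, exists n, val (t j) \in W n.
  by move=> j; apply: (tA j [::]).
(* The opposite product over the indices [j < j.+1] is [t j.+1 * t j], so [Wlt] applies with the
   later term on the left. *)
have ndec j : (n j.+1 < n j)%N.
  have [|k kP] := tA j [:: j.+1]; first by rewrite /= ltnSn.
  exact: Wlt (nP j.+1) (nP j) kP.
have njle j : (n j + j <= n 0)%N.
  elim: j => [|j IHj]; first by rewrite addn0.
  by apply: leq_trans IHj; rewrite addnS -addSn leq_add2r.
by have := leq_trans (leq_addl _ _) (njle (n 0%N).+1); rewrite ltnn.
Qed.
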